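(* Let $p\in(1,\infty)$, $\alpha\in(0,1)$, $\omega\in{\rm BUC}^\alpha(\mathbb{R})\cap L_p(\mathbb{R})$, and let $f:\mathbb{R}\to\mathbb{R}$ be a differentiable function with $f'\in{\rm BUC}^\alpha(\mathbb{R})$. Let $\Gamma_f:=\{(x,f(x)):x\in\mathbb{R}\}$, $\Omega_\pm:=\{(x,y)\in\mathbb{R}^2:\pm(y-f(x))>0\}$, and let $v:\mathbb{R}^2\setminus\Gamma_f\to\mathbb{R}^2$ be given by $$v(x,y):=\frac{1}{2\pi}\int_{\mathbb{R}}\frac{(f(s)-y,\,x-s)}{(x-s)^2+(y-f(s))^2}\,\omega(s)\,ds.$$ Then the restrictions $v_\pm:=v|_{\Omega_\pm}$ satisfy $v_\pm\in{\rm BUC}^\alpha(\Omega_\pm)$.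
   Context: For an open set $\Omega\subset\mathbb{R}^n$ and $\alpha\in(0,1)$, ${\rm BUC}^\alpha(\Omega)$ is the space of bounded uniformly continuous functions $u$ on $\Omega$ with $[u]_\alpha:=\sup_{x\ne y}\frac{|u(x)-u(y)|}{|x-y|^\alpha}<\infty$ (componentwise for vector-valued functions). *)

(* Defs.v *)
From mathcomp Require Import all_boot all_order all_algebra.
From mathcomp Require Import all_classical all_reals all_analysis.

Set Implicit Arguments.
Unset Strict Implicit.
Unset Printing Implicit Defensive.

Import Order.TTheory GRing.Theory Num.Theory.
Import numFieldNormedType.Exports.

Local Open Scope classical_set_scope.
Local Open Scope ring_scope.

Definition dist1 (R : realType) (x y : R) : R := `|x - y|.

(* The library norm on R * R is the sup norm, hence the explicit Euclidean
   distance. *)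
Definition dist2 (R : realType) (z w : R * R) : R :=
  Num.sqrt ((z.1 - w.1) ^+ 2 + (z.2 - w.2) ^+ 2).

(* The spaces below are described by predicates on total functions u that
   depend only on the restriction of u to Omega; d is the Euclidean distance of
   the ambient space (dist1 for R, dist2 for R * R). *)

Definition holder_seminorm (R : realType) (T : Type) (d : T -> T -> R)
    (alpha : R) (Omega : set T) (u : T -> R) : \bar R :=
  ereal_sup [set r : \bar R | exists x y : T,
    [/\ Omega x, Omega y, x <> y & r = (`|u x - u y| / d x y `^ alpha)%:E]].

Definition unif_continuous_on (R : realType) (T : Type) (d : T -> T -> R)
    (Omega : set T) (u : T -> R) : Prop :=
  forall eps : R, 0 < eps -> exists2 delta : R, 0 < delta &
    forall x y : T, Omega x -> Omega y -> d x y < delta -> `|u x - u y| < eps.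

Definition BUC (R : realType) (T : Type) (d : T -> T -> R)
    (alpha : R) (Omega : set T) (u : T -> R) : Prop :=
  [/\ [bounded u x | x in Omega],
      unif_continuous_on d Omega u &
      (holder_seminorm d alpha Omega u < +oo)%E].

Definition BUC_vec (R : realType) (T : Type) (d : T -> T -> R)
    (alpha : R) (Omega : set T) (u : T -> R * R) : Prop :=
  BUC d alpha Omega (fun z => (u z).1) /\ BUC d alpha Omega (fun z => (u z).2).

Definition Omega_plus (R : realType) (f : R -> R) : set (R * R) :=
  [set z | 0 < z.2 - f z.1].

Definition Omega_minus (R : realType) (f : R -> R) : set (R * R) :=
  [set z | 0 < - (z.2 - f z.1)].

(* Only meaningful off the graph of f, which meets neither Omega_plus f nor
   Omega_minus f; the values on the graph play no role. For f continuous and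
   omega in L_p, 1 < p < oo, the integrands are integrable at every point off
   the graph, by Hoelder's inequality, so Rintegral is the Lebesgue integral. *)
Definition velocity (R : realType) (f omega : R -> R) (z : R * R) : R * R :=
  let: (x, y) := z in
  ((2 * pi)^-1 * \int[@lebesgue_measure R]_s
     ((f s - y) / ((x - s) ^+ 2 + (y - f s) ^+ 2) * omega s),
   (2 * pi)^-1 * \int[@lebesgue_measure R]_s
     ((x - s) / ((x - s) ^+ 2 + (y - f s) ^+ 2) * omega s)).

(* Main.v *)
Require Import Defs.
From mathcomp Require Import all_boot all_order all_algebra.
From mathcomp Require Import all_classical all_reals all_analysis.
From mathcomp Require Import measurable_realfun ring lra.
Import Order.TTheory GRing.Theory Num.Theory.
Import numFieldNormedType.Exports.
Local Open Scope classical_set_scope.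
Local Open Scope ring_scope.

(** Identify [R * R] with the complex plane and put [gamma s = s + i f s]. Then
    [v.2 + i v.1] is [(2 pi)^-1] times the integral of [omega / (zeta - gamma)],
    a holomorphic function of [zeta] off the graph. With [omega = r gamma'], where
    [r = omega / gamma'] is again Hoelder continuous, its derivative at [zeta] is
    minus the integral of [(r s - r x) gamma' s / (zeta - gamma s) ^ 2]: the
    constant [r x] may be subtracted because [gamma' / (zeta - gamma) ^ 2] is the
    derivative of [(zeta - gamma)^-1], which vanishes at infinity. Since [f] is
    Lipschitz, [|zeta - gamma s|] is comparable to [|x - s| + t], where
    [t = y - f x] is the height of [zeta = x + i y] above the graph, so the
    derivative is O([t `^ (alpha - 1)]). Two points at distance [h] are joined by
    going up by a multiple of [h], across and down; integrating the derivative
    bound along this path gives the Hoelder estimate. Boundedness follows by going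
    up by one unit, where the integral is estimated by Young's inequality. The
    domain below the graph is reduced to the one above by reflection. *)

(** * The weights and their integrals over the line *)

(** Here [t] stands for a height above the graph at abscissa [x]. The exponents that occur are 1 for
    the Cauchy kernel, 2 for its gradient, [2 - alpha] after cancellation, and the conjugate
    exponent of [p] after Young's inequality. *)
Definition weight {R : realType} (q x t s : R) : R := (`|s - x| + t) `^ (- q).

Lemma weight_ge0 (R : realType) (q x t s : R) : 0 <= weight q x t s.
Proof. exact: powR_ge0. Qed.

Lemma continuous_powR_pos (R : realType) (g : R -> R) (a : R) :
  (forall s, 0 < g s) -> continuous g -> continuous (fun s => g s `^ a).
Proof.
move=> g0 cg s; apply: (@continuous_comp _ _ _ g (fun u => u `^ a)).
  exact: cg.
apply/differentiable_continuous/derivable1_diffP.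
by apply: derivable_powR; rewrite in_itv/= g0.
Qed.

Lemma continuous_weight (R : realType) (q x t : R) :
  0 < t -> continuous (weight q x t).
Proof.
move=> t0; apply: continuous_powR_pos => [s|s].
  by rewrite ltr_wpDl.
apply: cvgD; last exact: cvg_cst.
by apply: cvg_norm; apply: cvgB; [exact: cvg_id|exact: cvg_cst].
Qed.

Lemma cvg_powRN_pinfty (R : realType) (a t : R) : 0 < a ->
  (x + t) `^ (- a) @[x --> +oo] --> (0 : R).
Proof.
move=> a0; apply/cvgr0Pnorm_le => e e0; near=> x.
(* The threshold is the solution [z] of [z ^ (- a) = e]. *)
have xA : e `^ (- a^-1) <= x + t.
  by rewrite -lerBlDr; near: x; apply: nbhs_pinfty_ge; exact: num_real.
have xt0 : 0 < x + t by rewrite (lt_le_trans _ xA)// powR_gt0.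
rewrite ger0_norm ?powR_ge0// powRN -[leRHS]invrK lef_pV2 ?posrE ?invr_gt0//.
  have -> : e^-1 = (e `^ (- a^-1)) `^ a.
    by rewrite -powRrM mulNr mulVf ?gt_eqF// powR_inv1// ltW.
  by apply: ge0_ler_powR => //; rewrite ?nnegrE ?powR_ge0 ?ltW.
by rewrite powR_gt0.
Unshelve. all: end_near. Qed.

(** After translation by [x] the weight is even, so the integral is twice the one over the
    half-line. There the antiderivative [Fq] vanishes at infinity because [1 < q]. *)
Lemma integral_weight (R : realType) (q x t : R) : 1 < q -> 0 < t ->
  (\int[@lebesgue_measure R]_s (weight q x t s)%:E =
   (2 / (q - 1) * t `^ (1 - q))%:E)%E.
Proof.
move=> q1 t0.
have q10 : 0 < q - 1 by rewrite subr_gt0.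
pose G := weight q 0 t.
have dF : (derive1 (fun s : R => s - x)) = cst 1.
  by apply/funext => s; rewrite derive1E deriveB// derive_id derive_cst; exact: subr0.
have -> : (\int[@lebesgue_measure R]_s (weight q x t s)%:E =
    \int[@lebesgue_measure R]_s (G s)%:E)%E.
  rewrite [RHS](@increasing_ge0_integration_by_substitutionT _ (fun s => s - x)).
  - apply: eq_integral => s _; congr EFin.
    rewrite dF !fctE /G /weight /=. by rewrite mulr1 subr0.
  - by move=> a b ab; rewrite ltrD2r.
  - by rewrite dF => s; exact: cvg_cst.
  - by rewrite dF; exact: is_cvg_cst.
  - by rewrite dF; exact: is_cvg_cst.
  - by move=> s; exact: derivableB.
  - apply/cvgrNyPle => A; near=> s; rewrite lerBlDr; near: s.
    by apply: nbhs_ninfty_le; exact: num_real.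
  - apply/cvgryPge => A; near=> s; rewrite lerBrDr; near: s.
    by apply: nbhs_pinfty_ge; exact: num_real.
  - exact: continuous_weight.
  - by move=> s; exact: weight_ge0.
rewrite ge0_symfun_integralT; last 3 first.
- by move=> s; exact: weight_ge0.
- exact: continuous_weight.
- by move=> s; rewrite /G /weight /= !subr0 normrN.
rewrite -set_itvcy.
pose Fq (s : R) := (s + t) `^ (1 - q) / (1 - q).
have dFq (s : R) : 0 <= s -> is_derive s 1 Fq ((s + t) `^ (- q)).
  move=> s0.
  have st : 0 < s + t by rewrite ltr_wpDl.
  have h := is_derive1_powR (1 - q) st.
  have h1 : is_derive s 1 (fun u : R => u + t) 1.
    by rewrite -[X in is_derive _ _ _ X]addr0; exact: is_deriveD.
  have h2 := @is_derive1_comp _ (fun u => powR u (1 - q))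
    (fun u : R => u + t) s _ _ h h1.
  have h3 := @is_deriveZ _ _ _ _ (1 - q)^-1 _ _ _ h2.
  have -> : Fq = ((1 - q)^-1 \*: (powR (R:=R) ^~ (1 - q) \o +%R^~ t)).
    by apply/funext => u; rewrite /Fq /= mulrC.
  apply: is_derive_eq; rewrite /= mulr1 /GRing.scale /= mulrA mulVf ?mul1r.
    by congr (_ `^ _); ring.
  by rewrite lt_eqF// subr_lt0.
rewrite (@ge0_continuous_FTC2y _ _ Fq _ 0).
- rewrite -EFinB sub0r -EFinM /Fq add0r; congr EFin; field.
  by rewrite lt0r_neq0//= lt_eqF// subr_lt0.
- by move=> s _; exact: weight_ge0.
- by apply: continuous_subspaceT; exact: continuous_weight.
- have -> : 0 = 0 / (1 - q) by rewrite mul0r.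
  apply: cvgM; last exact: cvg_cst.
  rewrite -(opprB q 1); exact: cvg_powRN_pinfty.
- by move=> s s0; apply: ex_derive; apply: dFq; exact: ltW.
- apply: cvg_at_right_filter.
  apply/differentiable_continuous/derivable1_diffP.
  by apply: ex_derive; exact: dFq.
- move=> s; rewrite in_itv/= andbT => s0.
  rewrite derive1E; have [_ ->] := dFq _ (ltW s0).
  by rewrite /G /weight subr0 gtr0_norm.
Unshelve. all: end_near. Qed.

(** * Integrals of continuous functions dominated by weights *)

Notation integrableR h := ((@lebesgue_measure _).-integrable setT (EFin \o h)).

Lemma integrableRD (R : realType) (g h : R -> R) :
  integrableR g -> integrableR h -> integrableR (fun s => g s + h s).
Proof. by move=> ig ih; apply: eq_integrable (integrableD _ ig ih). Qed.

Lemma integrableRZ (R : realType) (C : R) (h : R -> R) :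
  integrableR h -> integrableR (fun s => C * h s).
Proof. by move=> ih; apply: eq_integrable (integrableZl _ C ih). Qed.

Lemma continuous_measurable_EFin (R : realType) (h : R -> R) :
  continuous h -> measurable_fun setT (EFin \o h).
Proof. by move=> ch; apply/measurable_EFinP; exact: continuous_measurable_fun. Qed.

Lemma integrableR_le (R : realType) (h w : R -> R) :
  continuous h -> (forall s, `|h s| <= w s) -> integrableR w -> integrableR h.
Proof.
move=> ch hw; apply: le_integrable => //.
  exact: continuous_measurable_EFin.
by move=> s _; rewrite lee_fin (le_trans (hw s)) ?ler_norm.
Qed.

Lemma Rintegral_norm_le (R : realType) (h w : R -> R) :
  continuous h -> (forall s, `|h s| <= w s) -> integrableR w ->
  `|\int[@lebesgue_measure R]_s h s| <= \int[@lebesgue_measure R]_s w s.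
Proof.
move=> ch hw iw; have ih := @integrableR_le _ _ _ ch hw iw.
apply: le_trans (le_normr_Rintegral _ ih) _ => //.
by apply: le_Rintegral => //; exact: integrable_norm.
Qed.

Lemma integrable_weight (R : realType) (q x t : R) : 1 < q -> 0 < t ->
  integrableR (weight q x t).
Proof.
move=> q1 t0; apply/integrableP; split.
  by apply: continuous_measurable_EFin; exact: continuous_weight.
under eq_integral do rewrite /= ger0_norm ?weight_ge0//.
by rewrite integral_weight// ltry.
Qed.

Lemma Rintegral_weight (R : realType) (q x t : R) : 1 < q -> 0 < t ->
  \int[@lebesgue_measure R]_s weight q x t s = 2 / (q - 1) * t `^ (1 - q).
Proof. by move=> q1 t0; rewrite /Rintegral integral_weight. Qed.

Lemma integrable_le_weight (R : realType) (h : R -> R) (C q x t : R) :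
  1 < q -> 0 < t -> continuous h -> (forall s, `|h s| <= C * weight q x t s) ->
  integrableR h.
Proof.
move=> q1 t0 ch hC; apply: integrableR_le ch hC _.
exact/integrableRZ/integrable_weight.
Qed.

Lemma Rintegral_le_weight (R : realType) (h : R -> R) (C q x t : R) :
  1 < q -> 0 < t -> continuous h -> (forall s, `|h s| <= C * weight q x t s) ->
  `|\int[@lebesgue_measure R]_s h s| <= C * (2 / (q - 1) * t `^ (1 - q)).
Proof.
move=> q1 t0 ch hC; have iw := @integrable_weight R q x t q1 t0.
rewrite -(Rintegral_weight _ _ x)// -RintegralZl//.
by apply: Rintegral_norm_le => //; exact: integrableRZ.
Qed.

(** * Vanishing integrals and the cancellation they allow *)

Lemma continuous_of_is_derive (R : realType) (phi dphi : R -> R) :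
  (forall s : R, is_derive s 1 phi (dphi s)) -> continuous phi.
Proof.
move=> d s; apply/differentiable_continuous/derivable1_diffP.
by apply: ex_derive; exact: d.
Qed.

(** Over an interval centred at [x] the integral is a boundary term, which tends to 0 with the decay
    of [phi]. Dominated convergence, with [|dphi|] as the bound, passes to the whole line. *)
Lemma Rintegral_derive_eq0 (R : realType) (phi dphi : R -> R) (C D q x t : R) :
  1 < q -> 0 < t -> (forall s : R, is_derive s 1 phi (dphi s)) ->
  continuous dphi -> (forall s, `|dphi s| <= C * weight q x t s) ->
  (forall s, `|phi s| <= D * weight 1 x t s) ->
  \int[@lebesgue_measure R]_s dphi s = 0.
Proof.
move=> q1 t0 dphiE cdphi dphiC phiD.
have cphi := @continuous_of_is_derive _ _ _ dphiE.
have idphi : integrableR dphi.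
  exact: (@integrable_le_weight _ dphi C q x t).
(* The radius is [n.+1] rather than [n], so that no interval is degenerate. *)
pose I (n : nat) : set R := [set` `[x - n.+1%:R, x + n.+1%:R]].
have xn (n : nat) : x - n.+1%:R < x + n.+1%:R.
  by rewrite ltrD2l gtrN// ltr0n.
have IE (n : nat) : (\int[@lebesgue_measure R]_s ((dphi \_ (I n)) s)%:E =
    (phi (x + n.+1%:R) - phi (x - n.+1%:R))%:E)%E.
  transitivity (\int[@lebesgue_measure R]_(s in I n) (dphi s)%:E)%E.
    by rewrite [RHS]integral_mkcond restrict_EFin.
  rewrite (@continuous_FTC2 _ _ phi)//.
  - exact: continuous_subspaceT.
  - split.
    + by move=> s _; apply: ex_derive; exact: dphiE.
    + exact/cvg_at_right_filter/cphi.
    + exact/cvg_at_left_filter/cphi.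
  - by move=> s _; rewrite derive1E; have [_] := dphiE s.
have lim1 : (\int[@lebesgue_measure R]_s ((dphi \_ (I n)) s)%:E @[n --> \oo] -->
    \int[@lebesgue_measure R]_s (dphi s)%:E)%E.
  have := (@dominated_cvg _ _ _ (@lebesgue_measure R) setT measurableT
    (fun n s => ((dphi \_ (I n)) s)%:E) (fun s => (dphi s)%:E)
    (fun s => `|dphi s|%:E)); apply => //=.
  - move=> n; apply/measurable_EFinP.
    have mI : measurable (I n) by exact: measurable_itv.
    apply: (measurable_restrictT _ mI).1.
    by apply: measurable_funTS; exact: continuous_measurable_fun.
  - move=> s _; apply: cvg_EFin; first exact: nearW.
    apply/cvgrPdist_le => e e0; near=> n.
    (* From this rank on [s] lies in [I n], so the truncated values are constant. *)
    have sn : `|s - x| <= n%:R by near: n; exact: nbhs_infty_ger.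
    have sI : s \in I n.
      rewrite inE /I /= in_itv/=.
      have : `|s - x| <= n.+1%:R by rewrite (le_trans sn)// ler_nat.
      by rewrite ler_norml => /andP[? ?]; apply/andP; split; lra.
    by rewrite /= patchE sI subrr normr0 ltW.
  - exact: integrable_norm idphi.
  - move=> n s _; rewrite lee_fin patchE; case: ifP => // _.
    by rewrite normr0.
(* Stated for any points at distance [n.+1] from [x], which covers both endpoints. *)
have phi0 (u : nat -> R) : (forall n, `|u n - x| = n.+1%:R) ->
    phi (u n) @[n --> \oo] --> (0 : R).
  move=> un; apply: norm_cvg0.
  apply: (@squeeze_cvgr _ _ _ _ (cst 0) (fun n => D * (n.+1%:R + t) `^ (-1))).
  - by apply: nearW => n; rewrite normr_ge0 (le_trans (phiD _))// /weight un.
  - exact: cvg_cst.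
  - rewrite -(mulr0 D); apply: cvgM; first exact: cvg_cst.
    apply: (@cvg_comp _ _ _ (fun n => n.+1%:R)
      (fun u : R => (u + t) `^ (-1)) _ (+oo%R)).
      by rewrite (cvg_shiftS (fun n => n%:R : R)); exact: cvgr_idn.
    exact: cvg_powRN_pinfty.
have lim2 : (phi (x + n.+1%:R) - phi (x - n.+1%:R))%:E @[n --> \oo] --> (0%:E : \bar R).
  apply: cvg_EFin; first exact: nearW.
  rewrite -(subrr (0 : R)); apply: cvgB; apply: phi0 => n.
    by rewrite addrAC subrr add0r normr_nat.
  by rewrite addrAC subrr add0r normrN normr_nat.
rewrite /Rintegral.
suff -> : (\int[@lebesgue_measure R]_s (dphi s)%:E = 0%:E)%E by [].
rewrite (funext IE) in lim1.
exact: (cvg_unique _ lim1 lim2).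
Unshelve. all: end_near. Qed.

(** Young's inequality, with the factors [1 / p] and [1 / q] bounded by 1. It trades a kernel that
    decays too slowly to be integrable for the integrable terms [|w| ^ p] and a weight of exponent
    greater than 1. *)
Lemma weight_young (R : realType) (p x t s w : R) : 1 < p -> 0 < t ->
  `|w| * weight 1 x t s <= `|w| `^ p + weight (p / (p - 1)) x t s.
Proof.
move=> p1 t0; set q := p / (p - 1).
have p0 : 0 < p by rewrite (lt_trans ltr01).
have p10 : 0 < p - 1 by rewrite subr_gt0.
have q1 : 1 < q by rewrite /q ltr_pdivlMr// mul1r gtrBl.
have q0 : 0 < q by rewrite (lt_trans ltr01).
have pq : p^-1 + q^-1 = 1.
  by rewrite /q invf_div -[X in X + _]div1r -mulrDl addrC subrK divff ?gt_eqF.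
apply: le_trans (conjugate_powR (normr_ge0 w) (weight_ge0 R 1 x t s) p0 q0 pq) _.
have -> : weight 1 x t s `^ q = weight q x t s.
  by rewrite /weight -powRrM mulNr mul1r.
by apply: lerD; rewrite ler_pdivrMr// ler_peMr ?powR_ge0// ltW.
Qed.

Lemma weight_prod (R : realType) (q r x t s : R) : 0 < t ->
  weight q x t s * weight r x t s = weight (q + r) x t s.
Proof.
move=> t0; rewrite /weight opprD powRD//; apply/implyP => _.
by rewrite gt_eqF// ltr_wpDl.
Qed.

(** As [U] has integral 0, [r s] may be replaced by [r s - r x]. Since [|s - x| ^ alpha] is at most
    [(|s - x| + t) ^ alpha], this lowers the exponent of the weight from 2 to [2 - alpha], which
    still exceeds 1, and the power of [t] improves accordingly. *)
Lemma Rintegral_cancel (R : realType) (r U : R -> R) (H C alpha x t : R) :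
  0 < alpha -> alpha < 1 -> 0 < t -> 0 <= H -> 0 <= C ->
  continuous r -> continuous U ->
  (forall s, `|r s - r x| <= H * `|s - x| `^ alpha) ->
  (forall s, `|U s| <= C * weight 2 x t s) ->
  \int[@lebesgue_measure R]_s U s = 0 ->
  `|\int[@lebesgue_measure R]_s (r s * U s)| <=
    H * C * (2 / (1 - alpha) * t `^ (alpha - 1)).
Proof.
move=> a0 a1 t0 H0 C0 cr cU rH UC U0.
have U2 : 1 < 2 :> R by rewrite ltr1n.
have iU : integrableR U by exact: (@integrable_le_weight _ U C 2 x t).
have crU : continuous (fun s => (r s - r x) * U s).
  by move=> s; apply: cvgM; [apply: cvgB; [exact: cr|exact: cvg_cst]|exact: cU].
have q1 : 1 < 2 - alpha by lra.
have bd s : `|(r s - r x) * U s| <= H * C * weight (2 - alpha) x t s.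
  rewrite normrM (le_trans (ler_pM _ _ (rH s) (UC s)))//.
  rewrite mulrACA ler_wpM2l ?mulr_ge0//.
  have -> : weight (2 - alpha) x t s = weight (- alpha) x t s * weight 2 x t s.
    by rewrite weight_prod// addrC.
  rewrite ler_wpM2r ?weight_ge0// /weight opprK.
  apply: ge0_ler_powR; rewrite ?nnegrE ?addr_ge0 ?(ltW a0) ?(ltW t0)//.
  by rewrite lerDl ltW.
have -> : \int[@lebesgue_measure R]_s (r s * U s) =
    \int[@lebesgue_measure R]_s ((r s - r x) * U s).
  transitivity (\int[@lebesgue_measure R]_s ((r s - r x) * U s + r x * U s)).
    by apply: eq_Rintegral => s _; rewrite mulrBl subrK.
  rewrite RintegralD//; last 2 first.
  - exact: (@integrable_le_weight _ _ (H * C) (2 - alpha) x t).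
  - exact: integrableRZ.
  by rewrite RintegralZl// U0 mulr0 addr0.
have := @Rintegral_le_weight _ _ (H * C) (2 - alpha) x t q1 t0 crU bd.
by congr (_ <= _ * (_ / _ * _ `^ _)); lra.
Qed.

(** * From derivative bounds to increments, and from increments to [BUC] *)

(** The bound on the derivative may blow up at 0, but [B / alpha * s ^ alpha] is a continuous
    antiderivative of it. Hence [c * phi] minus this function is nonincreasing on the closed
    interval for [c = 1] and [c = -1], which replaces an improper integral. *)
Lemma holder_increment (R : realType) (phi dphi : R -> R) (B alpha : R) :
  0 < alpha ->
  (forall s : R, 0 <= s <= 1 -> is_derive s 1 phi (dphi s)) ->
  (forall s, 0 < s < 1 -> `|dphi s| <= B * s `^ (alpha - 1)) ->
  `|phi 1 - phi 0| <= B / alpha.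
Proof.
move=> a0 dphiE dphiB.
pose G (c : R) (s : R) := c * phi s - B / alpha * s `^ alpha.
suff key (c : R) : `|c| = 1 -> c * (phi 1 - phi 0) <= B / alpha.
  rewrite ler_norml; apply/andP; split; last first.
    by rewrite -[leLHS]mul1r; apply: key; rewrite normr1.
  by rewrite lerNl -mulN1r; apply: key; rewrite normrN1.
move=> c1.
have dG (s : R) : s \in `]0, 1[ ->
    is_derive s 1 (G c) (c * dphi s - B * s `^ (alpha - 1)).
  rewrite in_itv/= => /andP[s0 s1].
  have d1 := dphiE s; rewrite !ltW// in d1; have {}d1 := d1 isT.
  have d2 := @is_derive1_powR _ alpha _ s0.
  have d3 := is_deriveB (is_deriveZ c d1) (is_deriveZ (B / alpha) d2).
  rewrite /G; apply: (is_derive_eq d3).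
  rewrite /GRing.scale/=; congr (_ - _).
  by rewrite mulrA divfK ?gt_eqF.
have cG : {within `[0, 1], continuous (G c)}.
  have cphi (s : R) : 0 <= s <= 1 -> {for s, continuous phi}.
    move=> s01; apply/differentiable_continuous/derivable1_diffP.
    by apply: ex_derive; exact: dphiE.
  have cpow (s : R) : 0 < s -> {for s, continuous (fun u => u `^ alpha)}.
    move=> s0; apply/differentiable_continuous/derivable1_diffP.
    by apply: ex_derive; exact: is_derive1_powR.
  apply/continuous_within_itvP => //; split.
  - move=> s; rewrite in_itv/= => /andP[s0 s1].
    apply: cvgB; (apply: cvgM; first exact: cvg_cst).
      by apply: cphi; rewrite !ltW.
    exact: cpow.
  (* At 0 the power need not be differentiable; its limit from the right comes from [powR_cvg0]. *)
  - apply: cvgB; (apply: cvgM; first exact: cvg_cst).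
      by apply: cvg_at_right_filter; apply: cphi; rewrite lexx ler01.
    by rewrite powR0 ?gt_eqF//; exact: powR_cvg0.
  - apply: cvg_at_left_filter; apply: cvgB; (apply: cvgM; first exact: cvg_cst).
      by apply: cphi; rewrite ler01 lexx.
    exact: cpow.
have : G c 1 <= G c 0.
  apply: (@ler0_derive1_nincr _ (G c) 0 1) => //.
  - by move=> s s01; apply: ex_derive; exact: dG.
  - move=> s s01; rewrite derive1E; have [_ ->] := dG s s01.
    move: s01; rewrite in_itv/= => s01.
    rewrite subr_le0 (le_trans (ler_norm _))// normrM c1 mul1r.
    exact: dphiB.
rewrite /G powR1 powR0 ?gt_eqF// mulr0 mulr1 mulrBr; lra.
Qed.

Lemma holder_seminorm_lty (R : realType) (T : Type) (d : T -> T -> R)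
    (alpha : R) (Omega : set T) (u : T -> R) :
  (forall x y, x <> y -> 0 < d x y) ->
  (holder_seminorm d alpha Omega u < +oo)%E ->
  exists2 H, 0 <= H & forall x y, Omega x -> Omega y ->
    `|u x - u y| <= H * d x y `^ alpha.
Proof.
move=> d0 uoo.
(* The maximum with 0 gives the sign at once: if [Omega] has fewer than two points, the supremum is
   [-oo]. *)
pose H := Num.max 0 (fine (holder_seminorm d alpha Omega u)).
exists H; first by rewrite /H le_max lexx.
move=> x y Ox Oy; have [<-|xy] := pselect (x = y).
  by rewrite subrr normr0 mulr_ge0 ?powR_ge0// /H le_max lexx.
have dxy : 0 < d x y `^ alpha by rewrite powR_gt0 ?d0.
rewrite -ler_pdivrMr//.
have : ((`|u x - u y| / d x y `^ alpha)%:E <= holder_seminorm d alpha Omega u)%E.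
  by apply: ereal_sup_ubound; exists x, y.
rewrite /H le_max; move: uoo; case: (holder_seminorm _ _ _ _) => [r _|//|//] /=.
by rewrite lee_fin => ->; rewrite orbT.
Qed.

Lemma BUC_of_holder (R : realType) (T : Type) (d : T -> T -> R)
    (alpha H B : R) (Omega : set T) (u : T -> R) :
  0 < alpha -> 0 <= H ->
  (forall x y, 0 <= d x y) -> (forall x y, x <> y -> 0 < d x y) ->
  (forall x, Omega x -> `|u x| <= B) ->
  (forall x y, Omega x -> Omega y -> `|u x - u y| <= H * d x y `^ alpha) ->
  BUC d alpha Omega u.
Proof.
move=> a0 H0 d0 dp uB uH; split.
- exists B; split; first exact: num_real.
  by move=> M BM x Ox /=; rewrite (le_trans (uB x Ox))// ltW.
- move=> e e0.
  have H1 : 0 < H + 1 by rewrite ltr_wpDl.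
  (* This is the [delta] with [(H + 1) * delta ^ alpha = e]; [H] itself could be 0. *)
  exists ((e / (H + 1)) `^ alpha^-1); first by rewrite powR_gt0 ?divr_gt0.
  move=> x y Ox Oy dxy; apply: le_lt_trans (uH x y Ox Oy) _.
  have : d x y `^ alpha < e / (H + 1).
    have := gt0_ltr_powR a0 (d0 x y) (powR_ge0 _ _) dxy.
    by rewrite -powRrM mulVf ?gt_eqF// powRr1// divr_ge0 ?ltW.
  rewrite ltr_pdivlMr// => h; apply: le_lt_trans h.
  by rewrite mulrC ler_wpM2l ?powR_ge0// lerDl.
- apply: (@le_lt_trans _ _ H%:E); last exact: ltry.
  apply: ub_ereal_sup => _ [x [y [Ox Oy xy ->]]].
  by rewrite lee_fin ler_pdivrMr ?powR_gt0 ?dp// uH.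
Qed.

(** * Components of the Cauchy kernel, of its derivative and of [1 / gamma'] *)

(* [ker 0 1 a b] and [ker 1 0 a b] are the real and the imaginary part of
   [(a + i b)^-1], whose complex derivative is [kerP a b + i kerQ a b];
   [dker c1 c2 e1 e2] is the derivative of [ker c1 c2] in direction [(e1, e2)]. *)
Section kernels.
Context {R : realType}.
Implicit Types a b c e : R.

Definition kerP a b := (b ^+ 2 - a ^+ 2) / (a ^+ 2 + b ^+ 2) ^+ 2.
Definition kerQ a b := 2 * a * b / (a ^+ 2 + b ^+ 2) ^+ 2.
Definition ker c1 c2 a b := (c2 * a - c1 * b) / (a ^+ 2 + b ^+ 2).
Definition dker c1 c2 e1 e2 a b :=
  c2 * (e1 * kerP a b - e2 * kerQ a b) + c1 * (e1 * kerQ a b + e2 * kerP a b).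

Lemma is_derive_ker c1 c2 (a b : R -> R) (s da db : R) :
  0 < a s ^+ 2 + b s ^+ 2 -> is_derive s 1 a da -> is_derive s 1 b db ->
  is_derive s 1 (fun u => ker c1 c2 (a u) (b u)) (dker c1 c2 da db (a s) (b s)).
Proof.
move=> D0 ha hb.
have hN : is_derive s 1 (fun u => c2 * a u - c1 * b u) (c2 * da - c1 * db).
  exact: (is_deriveB (is_deriveZ c2 ha) (is_deriveZ c1 hb)).
have hD : is_derive s 1 (fun u => a u ^+ 2 + b u ^+ 2)
    (2 * a s * da + 2 * b s * db).
  have h := is_deriveD (is_deriveM ha ha) (is_deriveM hb hb).
  have -> : (fun u => a u ^+ 2 + b u ^+ 2) = (a * a + b * b)%R.
    by apply/funext => u; rewrite !expr2.
  by apply: (is_derive_eq h); rewrite /GRing.scale/=; ring.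
have hV := @is_deriveV _ (fun u => a u ^+ 2 + b u ^+ 2) _ _ _ (lt0r_neq0 D0) hD.
have h := is_deriveM hN hV; rewrite /ker.
apply: (is_derive_eq h); rewrite /GRing.scale/= /dker /kerP /kerQ.
by field; rewrite lt0r_neq0.
Qed.

(** [kerP] and [kerQ] are the real and imaginary part of [- (a + i b) ^ (-2)], a number of modulus
    [(a ^ 2 + b ^ 2)^-1]. *)
Lemma norm_kerP_le a b : 0 < a ^+ 2 + b ^+ 2 -> `|kerP a b| <= (a ^+ 2 + b ^+ 2)^-1.
Proof.
move=> D0; rewrite /kerP normrM normfV (ger0_norm (sqr_ge0 _)).
rewrite ler_pdivrMr ?exprn_gt0// expr2 mulKf ?gt_eqF//.
have := sqr_ge0 a; have := sqr_ge0 b => ? ?.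
by rewrite ler_norml; apply/andP; split; lra.
Qed.

Lemma norm_kerQ_le a b : 0 < a ^+ 2 + b ^+ 2 -> `|kerQ a b| <= (a ^+ 2 + b ^+ 2)^-1.
Proof.
move=> D0; rewrite /kerQ normrM normfV (ger0_norm (sqr_ge0 (_ + _))).
rewrite ler_pdivrMr ?exprn_gt0// expr2 mulKf ?gt_eqF//.
have := sqr_ge0 (a + b); have := sqr_ge0 (a - b) => ? ?.
by rewrite ler_norml; apply/andP; split; nra.
Qed.

Lemma norm_dker_le c1 c2 e1 e2 a b : 0 < a ^+ 2 + b ^+ 2 ->
  `|dker c1 c2 e1 e2 a b| <=
  (`|c1| + `|c2|) * (`|e1| + `|e2|) * (a ^+ 2 + b ^+ 2)^-1.
Proof.
move=> D0; have hP := norm_kerP_le _ _ D0; have hQ := norm_kerQ_le _ _ D0.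
set V := _^-1 in hP hQ *.
have h u v : `|u| <= V -> `|v| <= V -> `|e1 * u + e2 * v| <= (`|e1| + `|e2|) * V.
  move=> uV vV; rewrite (le_trans (ler_normD _ _))// mulrDl.
  by rewrite !normrM lerD// ler_wpM2l.
rewrite /dker (le_trans (ler_normD _ _))// addrC -mulrA mulrDl.
rewrite lerD// normrM ler_wpM2l//.
  exact: h.
by rewrite -mulrN; apply: h => //; rewrite normrN.
Qed.

(** This function and the one of [ratio_mul_sub] are, up to sign, the real and imaginary part of
    [(1 + i u)^-1]. Being 1-Lipschitz, they keep the Hoelder constant of [f'] when composed with
    it. *)
Lemma ratio_sub (u v : R) : `|(1 + u ^+ 2)^-1 - (1 + v ^+ 2)^-1| <= `|u - v|.
Proof.
have u0 : 0 < 1 + u ^+ 2 by nra.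
have v0 : 0 < 1 + v ^+ 2 by nra.
have -> : (1 + u ^+ 2)^-1 - (1 + v ^+ 2)^-1 =
    (v + u) / ((1 + u ^+ 2) * (1 + v ^+ 2)) * (v - u).
  by field; rewrite !lt0r_neq0.
rewrite normrM distrC ler_piMl// normrM normfV.
rewrite [X in _ / X]gtr0_norm ?mulr_gt0// ler_pdivrMr ?mulr_gt0// mul1r.
have := sqr_ge0 (u * v); have := sqr_ge0 u; have := sqr_ge0 v.
have := sqr_ge0 (u - 1); have := sqr_ge0 (u + 1).
have := sqr_ge0 (v - 1); have := sqr_ge0 (v + 1) => *.
by rewrite ler_norml; apply/andP; split; nra.
Qed.

Lemma ratio_mul_sub (u v : R) : `|u / (1 + u ^+ 2) - v / (1 + v ^+ 2)| <= `|u - v|.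
Proof.
have u0 : 0 < 1 + u ^+ 2 by nra.
have v0 : 0 < 1 + v ^+ 2 by nra.
have -> : u / (1 + u ^+ 2) - v / (1 + v ^+ 2) =
    (1 - u * v) / ((1 + u ^+ 2) * (1 + v ^+ 2)) * (u - v).
  by field; rewrite !lt0r_neq0.
rewrite normrM ler_piMl// normrM normfV.
rewrite [X in _ / X]gtr0_norm ?mulr_gt0// ler_pdivrMr ?mulr_gt0// mul1r.
have := sqr_ge0 (u * v); have := sqr_ge0 u; have := sqr_ge0 v.
have := sqr_ge0 (u - v); have := sqr_ge0 (u + v) => *.
by rewrite ler_norml; apply/andP; split; nra.
Qed.

Lemma ratio_le1 (u : R) : `|(1 + u ^+ 2)^-1| <= 1.
Proof.
have u0 : 0 < 1 + u ^+ 2 by nra.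
by rewrite normfV gtr0_norm// invf_le1//; nra.
Qed.

Lemma ratio_mul_le1 (u : R) : `|u / (1 + u ^+ 2)| <= 1.
Proof.
have u0 : 0 < 1 + u ^+ 2 by nra.
rewrite normrM normfV [X in _ / X]gtr0_norm// ler_pdivrMr// mul1r.
have := sqr_ge0 (u - 1); have := sqr_ge0 (u + 1) => *.
by rewrite ler_norml; apply/andP; split; nra.
Qed.

(* Real and imaginary part of [w = r * gamma'], with [gamma' = 1 + i g] and
   [r = w (1 - i g) / (1 + g ^ 2)], multiplied by [kerP + i kerQ]. *)
Lemma kerP_decomp (g w a b : R) :
  w * kerP a b = w * (1 + g ^+ 2)^-1 * (kerP a b - g * kerQ a b) +
    w * (g / (1 + g ^+ 2)) * (kerQ a b + g * kerP a b).
Proof. by field; rewrite lt0r_neq0//; nra. Qed.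

Lemma kerQ_decomp (g w a b : R) :
  w * kerQ a b = w * (1 + g ^+ 2)^-1 * (kerQ a b + g * kerP a b) -
    w * (g / (1 + g ^+ 2)) * (kerP a b - g * kerQ a b).
Proof. by field; rewrite lt0r_neq0//; nra. Qed.

Lemma holder_mul (alpha x W Hw Hk : R) (w k : R -> R) :
  (forall s, `|w s| <= W) -> (forall s, `|k s| <= 1) ->
  (forall s, `|w s - w x| <= Hw * `|s - x| `^ alpha) ->
  (forall s, `|k s - k x| <= Hk * `|s - x| `^ alpha) ->
  forall s, `|w s * k s - w x * k x| <= (Hw + W * Hk) * `|s - x| `^ alpha.
Proof.
move=> wW k1 wH kH s.
have -> : w s * k s - w x * k x = (w s - w x) * k s + w x * (k s - k x) by ring.
rewrite (le_trans (ler_normD _ _))// !normrM mulrDl lerD//.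
  by rewrite (le_trans _ (wH s))// ler_piMr.
by rewrite -mulrA ler_pM.
Qed.

End kernels.

Lemma holder_continuous (R : realType) (alpha H : R) (u : R -> R) : 0 < alpha ->
  (forall x y, `|u x - u y| <= H * `|x - y| `^ alpha) -> continuous u.
Proof.
move=> a0 uH x; apply/cvgrPdist_lt => e e0.
(* The sign of [H] is not known here, hence the maximum with 0. *)
have H1 : 0 < Num.max H 0 + 1 by rewrite ltr_wpDl// le_max lexx orbT.
near=> y.
have h : `|x - y| < (e / (Num.max H 0 + 1)) `^ alpha^-1.
  near: y; apply/nbhs_ballP; exists ((e / (Num.max H 0 + 1)) `^ alpha^-1) => //=.
  by rewrite powR_gt0// divr_gt0.
have {}h : `|x - y| `^ alpha < e / (Num.max H 0 + 1).
  have := gt0_ltr_powR a0 (normr_ge0 (x - y)) (powR_ge0 _ _) h.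
  by rewrite -powRrM mulVf ?gt_eqF// powRr1// divr_ge0 ?ltW.
rewrite ltr_pdivlMr// in h; apply: le_lt_trans (uH x y) (le_lt_trans _ h).
rewrite mulrC ler_wpM2l ?powR_ge0//.
by apply: (@le_trans _ _ (Num.max H 0)); rewrite ?lerDl// le_max lexx.
Unshelve. all: end_near. Qed.

(** * Estimates above a Lipschitz graph *)

Section velocity_estimates.
Context {R : realType}.
Implicit Types c e x y d s : R.
(** The derivative of [f] is a separate variable [g] and all bounds are explicit constants, so that
    everything applies with the same constants to the reflected graph, that of [- f]. *)
Variables (p alpha L H W Hw : R) (f g w : R -> R).
Hypothesis p1 : 1 < p.
Hypothesis alpha0 : 0 < alpha.
Hypothesis alpha1 : alpha < 1.
Hypothesis L0 : 0 <= L.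
Hypothesis H0 : 0 <= H.
Hypothesis W0 : 0 <= W.
Hypothesis Hw0 : 0 <= Hw.
Hypothesis fE : forall x : R, is_derive x 1 f (g x).
Hypothesis gL : forall x, `|g x| <= L.
Hypothesis gH : forall x y, `|g x - g y| <= H * `|x - y| `^ alpha.
Hypothesis wW : forall x, `|w x| <= W.
Hypothesis wH : forall x y, `|w x - w y| <= Hw * `|x - y| `^ alpha.
Hypothesis iw : integrableR (fun s => `|w s| `^ p).

Let mu := @lebesgue_measure R.

Let cf : continuous f. Proof. exact: continuous_of_is_derive fE. Qed.
Let cg : continuous g. Proof. exact: holder_continuous alpha0 gH. Qed.
Let cw : continuous w. Proof. exact: holder_continuous alpha0 wH. Qed.

Let M0 : 0 <= 2 * (1 + L) ^+ 2. Proof. by rewrite mulr_ge0 ?exprn_ge0 ?addr_ge0. Qed.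

Lemma lipschitz_f x y : `|f x - f y| <= L * `|x - y|.
Proof.
wlog xy : x y / y <= x.
  move=> h; have [/h//|/ltW/h] := leP y x.
  by rewrite distrC [`|y - x|]distrC.
have [c _ ->] := @MVT_segment _ f g y x xy (fun x _ => fE x)
  (continuous_subspaceT cf).
by rewrite normrM ler_wpM2r.
Qed.

(** * Distance to the graph compared with abscissa plus height *)

(** Between the abscissae [x] and [s] the graph rises or falls by at most [L * |x - s|], so the
    height over [x] is at most [|y - f s| + L * |x - s|]. *)
Lemma height_le x y s : 0 < y - f x ->
  `|x - s| + (y - f x) <= (1 + L) * (`|x - s| + `|y - f s|).
Proof.
move=> t0; have := lipschitz_f s x; rewrite (distrC s) => hl.
have : y - f x <= `|y - f s| + L * `|x - s|.
  have -> : y - f x = (y - f s) + (f s - f x) by ring.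
  by rewrite lerD// (le_trans (ler_norm _)).
have := mulr_ge0 L0 (normr_ge0 (y - f s)).
by nra.
Qed.

(** The square of [height_le], with the factor 2 coming from
    [(|a| + |b|) ^ 2 <= 2 * (a ^ 2 + b ^ 2)]. It also shows that no denominator vanishes off the
    graph. *)
Lemma inv_sqr_le_weight x y s : 0 < y - f x ->
  0 < (x - s) ^+ 2 + (y - f s) ^+ 2 /\
  ((x - s) ^+ 2 + (y - f s) ^+ 2)^-1 <=
    2 * (1 + L) ^+ 2 * weight 2 x (y - f x) s.
Proof.
move=> t0; have := height_le x y s t0.
set a := x - s; set b := y - f s; set t := y - f x in t0 *.
have at0 : 0 < `|a| + t by rewrite ltr_wpDl.
have L1 : 0 < 1 + L by rewrite ltr_pwDl.
move=> hle.
have : (`|a| + t) ^+ 2 <= 2 * (1 + L) ^+ 2 * (a ^+ 2 + b ^+ 2).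
  apply: (@le_trans _ _ (((1 + L) * (`|a| + `|b|)) ^+ 2)).
    by rewrite ler_sqr ?nnegrE ?mulr_ge0 ?(ltW at0) ?(ltW L1) ?addr_ge0.
  have -> : 2 * (1 + L) ^+ 2 * (a ^+ 2 + b ^+ 2) =
    (1 + L) ^+ 2 * (2 * (a ^+ 2 + b ^+ 2)) by ring.
  rewrite exprMn ler_wpM2l ?sqr_ge0//.
  rewrite -(real_normK (num_real a)) -(real_normK (num_real b)).
  by have := sqr_ge0 (`|a| - `|b|); nra.
move=> hsq.
have D0 : 0 < a ^+ 2 + b ^+ 2.
  have : 0 < 2 * (1 + L) ^+ 2 * (a ^+ 2 + b ^+ 2).
    by apply: lt_le_trans hsq; rewrite exprn_gt0.
  by rewrite pmulr_rgt0// mulr_gt0// exprn_gt0.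
split=> //.
have -> : weight 2 x t s = ((`|a| + t) ^+ 2)^-1.
  by rewrite /weight (distrC s) -/a powR_invn// ltW.
by rewrite ler_pdivlMr ?exprn_gt0// mulrC ler_pdivrMr.
Qed.

Lemma norm_ker_le c1 c2 x y s : 0 < y - f x ->
  `|ker c1 c2 (x - s) (y - f s)| <=
    (`|c1| + `|c2|) * (2 * (1 + L)) * weight 1 x (y - f x) s.
Proof.
move=> t0; have := height_le x y s t0.
have [D0 _] := inv_sqr_le_weight x y s t0.
move: D0; set a := x - s; set b := y - f s; set t := y - f x in t0 * => D0 hle.
have at0 : 0 < `|a| + t by rewrite ltr_wpDl.
have -> : weight 1 x t s = (`|a| + t)^-1.
  by rewrite /weight (distrC s) -/a powR_inv1// ltW.
rewrite /ker normrM normfV (gtr0_norm D0).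
rewrite ler_pdivrMr// mulrAC ler_pdivlMr//.
apply: (@le_trans _ _ ((`|c1| + `|c2|) * (`|a| + `|b|) * (`|a| + t))).
  rewrite ler_wpM2r ?(ltW at0)// (le_trans (ler_normB _ _))// !normrM.
  have := mulr_ge0 (normr_ge0 c1) (normr_ge0 a).
  have := mulr_ge0 (normr_ge0 c2) (normr_ge0 b).
  by nra.
rewrite -!mulrA ler_wpM2l ?addr_ge0//.
apply: (@le_trans _ _ ((`|a| + `|b|) * ((1 + L) * (`|a| + `|b|)))).
  by rewrite ler_wpM2l ?addr_ge0.
rewrite [leLHS]mulrCA [leRHS]mulrCA ler_wpM2l ?addr_ge0//.
rewrite -(real_normK (num_real a)) -(real_normK (num_real b)).
by have := sqr_ge0 (`|a| - `|b|); nra.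
Qed.

(** * The kernel along the curve and the gradient bound *)

Lemma is_derive_ker_curve c1 c2 x y (s : R) : 0 < y - f x ->
  is_derive s 1 (fun u => ker c1 c2 (x - u) (y - f u))
    (dker c1 c2 (-1) (- g s) (x - s) (y - f s)).
Proof.
move=> t0; have [D0 _] := inv_sqr_le_weight x y s t0.
apply: is_derive_ker => //.
  rewrite -[X in is_derive _ _ _ X]add0r.
  exact: (is_deriveB (is_derive_cst x s 1) (is_derive_id s 1)).
rewrite -[X in is_derive _ _ _ X]add0r.
exact: (is_deriveB (is_derive_cst y s 1) (fE s)).
Qed.

Lemma continuous_kerPQ x y : 0 < y - f x ->
  continuous (fun s => kerP (x - s) (y - f s)) /\
  continuous (fun s => kerQ (x - s) (y - f s)).
Proof.
move=> t0.
have ca : continuous (fun s => x - s).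
  by move=> s; apply: cvgB; [exact: cvg_cst|exact: cvg_id].
have cb : continuous (fun s => y - f s).
  by move=> s; apply: cvgB; [exact: cvg_cst|exact: cf].
have cV : continuous (fun s => (((x - s) ^+ 2 + (y - f s) ^+ 2) ^+ 2)^-1).
  move=> s; apply: cvgV.
    have [D0 _] := inv_sqr_le_weight x y s t0.
    by rewrite expf_neq0// lt0r_neq0.
  by apply: cvgM; (apply: cvgD; apply: cvgM; by [exact: ca|exact: cb]).
split=> s; apply: cvgM; [|exact: cV| |exact: cV].
  by apply: cvgB; apply: cvgM; by [exact: ca|exact: cb].
by apply: cvgM; [apply: cvgM; [exact: cvg_cst|exact: ca]|exact: cb].
Qed.

Lemma continuous_dker c1 c2 e1 (e2 : R -> R) x y : continuous e2 -> 0 < y - f x ->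
  continuous (fun s => dker c1 c2 e1 (e2 s) (x - s) (y - f s)).
Proof.
move=> ce t0; have [cP cQ] := continuous_kerPQ x y t0.
move=> s; rewrite /dker; apply: cvgD; apply: cvgM; try exact: cvg_cst.
  by apply: cvgB; apply: cvgM; by [exact: cvg_cst|exact: ce|exact: cP|exact: cQ].
by apply: cvgD; apply: cvgM; by [exact: cvg_cst|exact: ce|exact: cP|exact: cQ].
Qed.

Lemma norm_dker_le_weight c1 c2 e1 e2 x y s : 0 < y - f x ->
  `|dker c1 c2 e1 e2 (x - s) (y - f s)| <=
  (`|c1| + `|c2|) * (`|e1| + `|e2|) * (2 * (1 + L) ^+ 2)
    * weight 2 x (y - f x) s.
Proof.
move=> t0; have [D0 DM] := inv_sqr_le_weight x y s t0.
apply: le_trans (norm_dker_le _ _ _ _ _ _ D0) _.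
by rewrite -[leRHS]mulrA ler_wpM2l// mulr_ge0// addr_ge0.
Qed.

(* Along the curve [dker] is the derivative in [s] of [ker]. *)
Lemma Rintegral_dker_curve c1 c2 x y : 0 < y - f x ->
  \int[mu]_s dker c1 c2 (-1) (- g s) (x - s) (y - f s) = 0.
Proof.
move=> t0.
have h1 s : `|dker c1 c2 (-1) (- g s) (x - s) (y - f s)| <=
    (`|c1| + `|c2|) * (1 + L) * (2 * (1 + L) ^+ 2) * weight 2 x (y - f x) s.
  apply: le_trans (norm_dker_le_weight _ _ _ _ _ _ _ t0) _.
  rewrite ler_wpM2r ?weight_ge0// ler_wpM2r ?M0//.
  by rewrite ler_wpM2l ?addr_ge0// normrN1 normrN lerD.
have h2 := norm_ker_le c1 c2 x y ^~ t0.
have h3 := is_derive_ker_curve c1 c2 x y ^~ t0.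
have h4 : continuous (fun s => dker c1 c2 (-1) (- g s) (x - s) (y - f s)).
  by apply: continuous_dker => // s; apply: cvgN; exact: cg.
have U2 : 1 < 2 :> R by rewrite ltr1n.
exact: (Rintegral_derive_eq0 _ _ _ _ _ _ x _ U2 t0 h3 h4 h1 h2).
Qed.

(** Twice the constant of [Rintegral_cancel], since each gradient component is a sum or difference
    of two products to which cancellation applies. *)
Definition grad_const : R :=
  2 * ((Hw + W * H) * ((1 + L) * (2 * (1 + L) ^+ 2)) * (2 / (1 - alpha))).

Lemma grad_bound x y : 0 < y - f x ->
  `|\int[mu]_s (w s * kerP (x - s) (y - f s))| <=
    grad_const * (y - f x) `^ (alpha - 1) /\
  `|\int[mu]_s (w s * kerQ (x - s) (y - f s))| <=
    grad_const * (y - f x) `^ (alpha - 1).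
Proof.
move=> t0.
(* [U + i V] equals [gamma' * (kerP + i kerQ)], written through derivatives along the curve so that
   both integrals vanish; [r1 - i r2] is [w / gamma']. *)
pose U s := dker 0 (-1) (-1) (- g s) (x - s) (y - f s).
pose V s := dker (-1) 0 (-1) (- g s) (x - s) (y - f s).
pose r1 s := w s * (1 + g s ^+ 2)^-1.
pose r2 s := w s * (g s / (1 + g s ^+ 2)).
have U2 : 1 < 2 :> R by rewrite ltr1n.
have PE s : w s * kerP (x - s) (y - f s) = r1 s * U s + r2 s * V s.
  by rewrite (kerP_decomp (g s)) /r1 /r2 /U /V /dker; congr (_ + _); ring.
have QE s : w s * kerQ (x - s) (y - f s) = r1 s * V s - r2 s * U s.
  by rewrite (kerQ_decomp (g s)) /r1 /r2 /U /V /dker; congr (_ - _); ring.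
have cN : continuous (fun s => - g s) by move=> s; apply: cvgN; exact: cg.
have cU : continuous U by exact: continuous_dker.
have cV : continuous V by exact: continuous_dker.
have cr : continuous r1 /\ continuous r2.
  have ci : continuous (fun s => (1 + g s ^+ 2)^-1).
    move=> s; apply: cvgV; first by rewrite lt0r_neq0// ltr_pwDl ?sqr_ge0.
    by apply: cvgD; [exact: cvg_cst|apply: cvgM; exact: cg].
  split=> s; (apply: cvgM; first exact: cw); first exact: ci.
  by apply: cvgM; [exact: cg|exact: ci].
have [cr1 cr2] := cr.
pose C := (1 + L) * (2 * (1 + L) ^+ 2).
have C0 : 0 <= C by rewrite mulr_ge0 ?addr_ge0 ?M0.
have Ub s : `|U s| <= C * weight 2 x (y - f x) s.
  apply: le_trans (norm_dker_le_weight _ _ _ _ _ _ _ t0) _.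
  rewrite normr0 add0r !normrN normr1 mul1r ler_wpM2r ?weight_ge0//.
  by rewrite ler_wpM2r ?lerD// M0.
have Vb s : `|V s| <= C * weight 2 x (y - f x) s.
  apply: le_trans (norm_dker_le_weight _ _ _ _ _ _ _ t0) _.
  rewrite normr0 addr0 !normrN normr1 mul1r ler_wpM2r ?weight_ge0//.
  by rewrite ler_wpM2r ?lerD// M0.
have Ui : \int[mu]_s U s = 0 by exact: Rintegral_dker_curve.
have Vi : \int[mu]_s V s = 0 by exact: Rintegral_dker_curve.
have r1H s : `|r1 s - r1 x| <= (Hw + W * H) * `|s - x| `^ alpha.
  apply: (holder_mul alpha x W Hw H w (fun s => (1 + g s ^+ 2)^-1)) => // {}s.
    exact: ratio_le1.
  exact: le_trans (ratio_sub _ _) (gH _ _).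
have r2H s : `|r2 s - r2 x| <= (Hw + W * H) * `|s - x| `^ alpha.
  apply: (holder_mul alpha x W Hw H w (fun s => g s / (1 + g s ^+ 2))) => // {}s.
    exact: ratio_mul_le1.
  exact: le_trans (ratio_mul_sub _ _) (gH _ _).
have HH : 0 <= Hw + W * H by rewrite addr_ge0// mulr_ge0.
have irU (r X : R -> R) : (forall s, `|r s| <= W) ->
    continuous r -> continuous X ->
    (forall s, `|X s| <= C * weight 2 x (y - f x) s) ->
    integrableR (fun s => r s * X s).
  move=> rW cr' cX Xb.
  apply: (@integrable_le_weight _ _ (W * C) 2 x (y - f x)) => //.
    by move=> s; apply: cvgM; [exact: cr'|exact: cX].
  by move=> s; rewrite normrM -mulrA ler_pM.
have r1W s : `|r1 s| <= W.
  by rewrite normrM (le_trans _ (wW s))// ler_piMr// ratio_le1.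
have r2W s : `|r2 s| <= W.
  by rewrite normrM (le_trans _ (wW s))// ler_piMr// ratio_mul_le1.
have bd (r X : R -> R) := @Rintegral_cancel R r X (Hw + W * H) C alpha x _
  alpha0 alpha1 t0 HH C0.
have gE : grad_const * (y - f x) `^ (alpha - 1) =
    (Hw + W * H) * C * (2 / (1 - alpha) * (y - f x) `^ (alpha - 1)) +
    (Hw + W * H) * C * (2 / (1 - alpha) * (y - f x) `^ (alpha - 1)).
  by rewrite /grad_const /C; ring.
split.
- under eq_Rintegral do rewrite PE.
  rewrite RintegralD//; [|exact: irU|exact: irU].
  by rewrite gE (le_trans (ler_normD _ _))// lerD//; exact: bd.
- under eq_Rintegral do rewrite QE.
  rewrite RintegralB//; [|exact: irU|exact: irU].
  by rewrite gE (le_trans (ler_normB _ _))// lerD//; exact: bd.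
Qed.

(** * The potentials and their bound far from the graph *)

(** [pot 1 0] and [pot 0 1] are [2 * pi] times the two components of the velocity. Free coefficients
    treat both at once and allow for the sign that reflection produces. *)
Definition pot c1 c2 x y : R := \int[mu]_s (ker c1 c2 (x - s) (y - f s) * w s).

Lemma continuous_ker c1 c2 x y : 0 < y - f x ->
  continuous (fun s => ker c1 c2 (x - s) (y - f s) * w s).
Proof.
move=> t0 s; apply: cvgM; last exact: cw.
exact: (continuous_of_is_derive _ _ _ (is_derive_ker_curve c1 c2 x y ^~ t0)).
Qed.

Definition conj_exp : R := p / (p - 1).

Lemma conj_exp_gt1 : 1 < conj_exp.
Proof. by rewrite /conj_exp ltr_pdivlMr ?subr_gt0// mul1r gtrBl. Qed.

Lemma norm_ker_mul_le c1 c2 x y s : 0 < y - f x ->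
  `|ker c1 c2 (x - s) (y - f s) * w s| <= (`|c1| + `|c2|) * (2 * (1 + L)) *
    (`|w s| `^ p + weight conj_exp x (y - f x) s).
Proof.
move=> t0; rewrite normrM.
apply: le_trans (ler_wpM2r (normr_ge0 _) (norm_ker_le c1 c2 x y s t0)) _.
rewrite -[leLHS]mulrA ler_wpM2l ?mulr_ge0 ?addr_ge0//.
by rewrite mulrC weight_young.
Qed.

Lemma integrable_ker_bound x y C : 0 < y - f x ->
  integrableR (fun s => C * (`|w s| `^ p + weight conj_exp x (y - f x) s)).
Proof.
move=> t0; apply: integrableRZ; apply: integrableRD => //.
exact: integrable_weight conj_exp_gt1 t0.
Qed.

Lemma integrable_ker c1 c2 x y : 0 < y - f x ->
  integrableR (fun s => ker c1 c2 (x - s) (y - f s) * w s).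
Proof.
move=> t0; apply: integrableR_le (continuous_ker c1 c2 x y t0) _
  (integrable_ker_bound x y _ t0) => s.
exact: norm_ker_mul_le.
Qed.

Definition far_const c1 c2 : R := (`|c1| + `|c2|) * (2 * (1 + L)) *
  (\int[mu]_s (`|w s| `^ p) + 2 / (conj_exp - 1)).

(** At height at least 1 the factor [t ^ (1 - conj_exp)] left by the weight is at most 1, so the
    bound is uniform. *)
Lemma norm_pot_far_le c1 c2 x y : 1 <= y - f x ->
  `|pot c1 c2 x y| <= far_const c1 c2.
Proof.
move=> t1; have t0 : 0 < y - f x by rewrite (lt_le_trans ltr01).
have q1 := conj_exp_gt1.
apply: le_trans (Rintegral_norm_le _ _ _ (continuous_ker c1 c2 x y t0) _
  (integrable_ker_bound x y ((`|c1| + `|c2|) * (2 * (1 + L))) t0)) _.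
  by move=> s; exact: norm_ker_mul_le.
have iwt := integrable_weight R conj_exp x (y - f x) q1 t0.
rewrite RintegralZl//; last exact: integrableRD.
rewrite ler_wpM2l ?mulr_ge0 ?addr_ge0// RintegralD// lerD2l.
rewrite Rintegral_weight// ler_piMr ?divr_ge0 ?subr_ge0 ?(ltW q1)//.
by rewrite -[leRHS](powRr0 (y - f x)) ler_powR// subr_le0 ltW.
Qed.

(** * Differentiation of the potentials along a line *)

(** A displacement by [(d * e1, d * e2)] lowers the height by at most [|d| * (|e2| + L * |e1|)] and
    moves the abscissa by [|d| * |e1|]; the coefficient [1 + L] pays for both. This gives one
    dominating weight for all nearby points. *)
Lemma height_near x y e1 e2 d s : 0 < y - f x ->
  `|d| * (`|e2| + (1 + L) * `|e1|) <= (y - f x) / 2 ->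
  (y - f x) / 2 <= y + d * e2 - f (x + d * e1) /\
  `|s - x| + (y - f x) / 2 <=
    `|s - (x + d * e1)| + (y + d * e2 - f (x + d * e1)).
Proof.
move=> t0 hd.
have hf := lipschitz_f (x + d * e1) x.
have hfx : f (x + d * e1) <= f x + L * (`|d| * `|e1|).
  have -> : f (x + d * e1) = f x + (f (x + d * e1) - f x) by ring.
  rewrite lerD2l (le_trans (ler_norm _))// (le_trans hf)//.
  by rewrite addrAC subrr add0r normrM.
have h2 : - (`|d| * `|e2|) <= d * e2.
  by rewrite -normrM lerNl -normrN ler_norm.
have h3 : `|s - x| <= `|s - (x + d * e1)| + `|d| * `|e1|.
  rewrite -normrM; have -> : s - x = s - (x + d * e1) + d * e1 by ring.
  exact: ler_normD.
have h4 : 0 <= `|d| * `|e1| by rewrite mulr_ge0.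
by split; nra.
Qed.

Lemma is_derive_pot c1 c2 x y e1 e2 (u : R) :
  0 < y + u * e2 - f (x + u * e1) ->
  is_derive u 1 (fun v => pot c1 c2 (x + v * e1) (y + v * e2))
    (\int[mu]_s (dker c1 c2 e1 e2 (x + u * e1 - s) (y + u * e2 - f s) * w s)).
Proof.
set X := x + u * e1; set Y := y + u * e2 => t0.
pose K (v s : R) := ker c1 c2 (x + v * e1 - s) (y + v * e2 - f s) * w s.
pose k := `|e2| + (1 + L) * `|e1|.
have k0 : 0 <= k by rewrite addr_ge0// mulr_ge0// addr_ge0.
have k1 : 0 < 1 + k by rewrite ltr_pwDl.
(* Small enough to use up at most half of the height; [1 + k] avoids dividing by 0 when the
   direction is null. *)
pose d := (Y - f X) / 2 / (1 + k).
have d0 : 0 < d by rewrite !divr_gt0.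
have uI : `]u - d, u + d[%classic u.
  by rewrite /= in_itv/= ltrBlDr ltrDl d0.
have near_u v s : `]u - d, u + d[%classic v ->
    (Y - f X) / 2 <= y + v * e2 - f (x + v * e1) /\
    `|s - X| + (Y - f X) / 2 <=
      `|s - (x + v * e1)| + (y + v * e2 - f (x + v * e1)).
  rewrite /= in_itv/= => /andP[v1 v2].
  have -> : x + v * e1 = X + (v - u) * e1 by rewrite /X; ring.
  have -> : y + v * e2 = Y + (v - u) * e2 by rewrite /Y; ring.
  apply: height_near => //; rewrite -/k.
  have vd : `|v - u| <= d by rewrite ler_norml; apply/andP; split; lra.
  apply: (@le_trans _ _ (d * (1 + k))); last by rewrite /d divfK ?gt_eqF.
  by apply: ler_pM => //; rewrite lerDr.
have height_pos v : `]u - d, u + d[%classic v -> 0 < y + v * e2 - f (x + v * e1).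
  by move=> /(near_u v 0)[+ _]; apply: lt_le_trans; rewrite divr_gt0.
have dK v s : `]u - d, u + d[%classic v ->
    is_derive v 1 (K ^~ s)
      (dker c1 c2 e1 e2 (x + v * e1 - s) (y + v * e2 - f s) * w s).
  move=> /height_pos tv.
  have [D0 _] := inv_sqr_le_weight _ _ s tv.
  have daff (z e r : R) : is_derive v 1 (fun v => z + v * e - r) e.
    have h := is_deriveB (is_deriveD (is_derive_cst z v 1)
      (is_deriveM (is_derive_id v 1) (is_derive_cst e v 1))) (is_derive_cst r v 1).
    by apply: (is_derive_eq h); rewrite /GRing.scale/=; ring.
  have h1 := is_derive_ker c1 c2 _ _ v _ _ D0 (daff x e1 s) (daff y e2 (f s)).
  have h := is_deriveM h1 (is_derive_cst (w s) v 1).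
  by apply: (is_derive_eq h); rewrite /GRing.scale/=; ring.
pose C := (`|c1| + `|c2|) * (`|e1| + `|e2|) * (2 * (1 + L) ^+ 2).
have C0 : 0 <= C by rewrite !mulr_ge0 ?addr_ge0 ?exprn_ge0 ?addr_ge0.
(* The dominating function: the weight at half the height over [X], independent of [v]. *)
pose G (s : R) := C * weight 2 X ((Y - f X) / 2) s * W.
have th : 0 < (Y - f X) / 2 by rewrite divr_gt0.
have U2 : 1 < 2 :> R by rewrite ltr1n.
have G0 s : 0 <= G s.
  by apply: mulr_ge0 => //; apply: mulr_ge0 => //; exact: weight_ge0.
have iG : integrableR G.
  rewrite (_ : G = fun s => W * (C * weight 2 X ((Y - f X) / 2) s)); last first.
    by apply/funext => s; rewrite mulrC.
  by do 2 apply: integrableRZ; exact: integrable_weight.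
have iK v : `]u - d, u + d[%classic v -> mu.-integrable setT (EFin \o K v).
  by move=> /height_pos tv; exact: integrable_ker.
have derK v s : `]u - d, u + d[%classic v -> setT s -> derivable (K ^~ s) v 1.
  by move=> vI _; have [] := dK v s vI.
have Gub v s : `]u - d, u + d[%classic v -> setT s -> `|partial1of2 K v s| <= G s.
  move=> vI _; rewrite partial1of2E; have [_ ->] := dK v s vI.
  rewrite normrM ler_pM//.
  apply: le_trans (norm_dker_le_weight _ _ _ _ _ _ _ (height_pos _ vI)) _.
  rewrite ler_wpM2l//.
  have [_ h] := near_u v s vI.
  have pos : 0 < `|s - X| + (Y - f X) / 2 by rewrite ltr_wpDl.
  rewrite /weight !powR_invn ?(ltW pos) ?(le_trans (ltW pos) h)//.
  rewrite lef_pV2 ?posrE ?exprn_gt0 ?(lt_le_trans pos h)//.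
  by rewrite ler_sqr ?nnegrE ?(ltW pos) ?(le_trans (ltW pos) h).
apply: DeriveDef.
  exact: (derivable_under_integral measurableT uI iK derK G0 iG Gub).
rewrite -derive1E.
have := differentiation_under_integral measurableT uI iK derK G0 iG Gub.
rewrite /pot => ->; apply: eq_Rintegral => s _.
by rewrite partial1of2E; have [_ ->] := dK u s uI.
Qed.

(** The direction does not depend on [s], so the integral is a combination, with constant
    coefficients, of the two integrals in [grad_bound]. *)
Lemma norm_Rintegral_dker_le c1 c2 e1 e2 x y : 0 < y - f x ->
  `|\int[mu]_s (dker c1 c2 e1 e2 (x - s) (y - f s) * w s)| <=
  (`|c1| + `|c2|) * (`|e1| + `|e2|) * (grad_const * (y - f x) `^ (alpha - 1)).
Proof.
move=> t0; have [bP bQ] := grad_bound x y t0.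
have [cP cQ] := continuous_kerPQ x y t0.
have iwk (k : R -> R) : continuous k ->
    (forall s, `|k s| <= ((x - s) ^+ 2 + (y - f s) ^+ 2)^-1) ->
    integrableR (fun s => w s * k s).
  move=> ck kD.
  apply: (@integrable_le_weight _ _ (W * (2 * (1 + L) ^+ 2)) 2 x (y - f x)) => //.
  - by rewrite ltr1n.
  - by move=> s; apply: cvgM; [exact: cw|exact: ck].
  - move=> s; have [_ DM] := inv_sqr_le_weight x y s t0.
    by rewrite normrM -mulrA ler_pM// (le_trans (kD s)).
have iP := iwk _ cP (fun s => norm_kerP_le _ _ (inv_sqr_le_weight x y s t0).1).
have iQ := iwk _ cQ (fun s => norm_kerQ_le _ _ (inv_sqr_le_weight x y s t0).1).
have -> : \int[mu]_s (dker c1 c2 e1 e2 (x - s) (y - f s) * w s) =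
    (c2 * e1 + c1 * e2) * \int[mu]_s (w s * kerP (x - s) (y - f s)) +
    (c1 * e1 - c2 * e2) * \int[mu]_s (w s * kerQ (x - s) (y - f s)).
  rewrite -RintegralZl// -RintegralZl// -RintegralD//; last 2 first.
  - exact: integrableRZ.
  - exact: integrableRZ.
  by apply: eq_Rintegral => s _; rewrite /dker; ring.
have h (k I B : R) : `|I| <= B -> `|k * I| <= `|k| * B.
  by move=> IB; rewrite normrM ler_wpM2l.
rewrite (le_trans (ler_normD _ _))// (le_trans (lerD (h _ _ _ bP) (h _ _ _ bQ)))//.
rewrite -mulrDl ler_wpM2r//; first exact: le_trans (normr_ge0 _) bP.
rewrite (le_trans (lerD (ler_normD _ _) (ler_normB _ _)))// !normrM.
by rewrite le_eqVlt; apply/orP; left; apply/eqP; ring.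
Qed.

(** * Hoelder estimate by going up, across and down *)

Definition seg_const c1 c2 : R := (`|c1| + `|c2|) * 2 * grad_const / alpha.

Lemma grad_const_ge0 : 0 <= grad_const.
Proof.
apply: mulr_ge0 => //; apply: mulr_ge0; last by rewrite divr_ge0 ?subr_ge0 ?ltW.
apply: mulr_ge0; first by apply: addr_ge0 => //; exact: mulr_ge0.
by apply: mulr_ge0 => //; exact: addr_ge0.
Qed.

Lemma seg_const_ge0 c1 c2 : 0 <= seg_const c1 c2.
Proof.
rewrite /seg_const divr_ge0 ?(ltW alpha0)//.
by apply: mulr_ge0 grad_const_ge0; apply: mulr_ge0 => //; exact: addr_ge0.
Qed.

(** At parameter [v] the gradient is O([(rho * v) ^ (alpha - 1)]) and the displacement is at most
    [2 * rho]. The derivative is therefore O([rho ^ alpha * v ^ (alpha - 1)]), the case of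
    [holder_increment]. The endpoint conditions are separate because the last one covers only the
    open interval. *)
Lemma pot_segment c1 c2 x y e1 e2 (rho : R) : 0 < rho ->
  `|e1| + `|e2| <= 2 * rho ->
  0 < y - f x -> 0 < y + e2 - f (x + e1) ->
  (forall v, 0 < v < 1 -> rho * v <= y + v * e2 - f (x + v * e1)) ->
  `|pot c1 c2 (x + e1) (y + e2) - pot c1 c2 x y| <= seg_const c1 c2 * rho `^ alpha.
Proof.
move=> rho0 erho t0 t1 hv.
pose phi (v : R) := pot c1 c2 (x + v * e1) (y + v * e2).
have phi1 : phi 1 = pot c1 c2 (x + e1) (y + e2) by rewrite /phi !mul1r.
have phi0 : phi 0 = pot c1 c2 x y by rewrite /phi !mul0r !addr0.
rewrite -phi1 -phi0.
pose dphi (v : R) := \int[mu]_s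
  (dker c1 c2 e1 e2 (x + v * e1 - s) (y + v * e2 - f s) * w s).
have pos v : 0 <= v <= 1 -> 0 < y + v * e2 - f (x + v * e1).
  rewrite le_eqVlt => /andP[/predU1P[<- _|v0]]; first by rewrite !mul0r !addr0.
  rewrite le_eqVlt => /predU1P[->|v1]; first by rewrite !mul1r.
  by apply: lt_le_trans (hv v _); rewrite ?mulr_gt0// v0.
have -> : seg_const c1 c2 * rho `^ alpha =
    (`|c1| + `|c2|) * 2 * grad_const * rho `^ alpha / alpha.
  by rewrite /seg_const mulrAC.
apply: (@holder_increment _ phi dphi).
- exact: alpha0.
- by move=> v v01; apply: is_derive_pot; exact: pos.
- move=> v v01; have [v0 v1] := andP v01.
  have tv : 0 < y + v * e2 - f (x + v * e1) by rewrite pos// !ltW.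
  apply: le_trans (norm_Rintegral_dker_le _ _ _ _ _ _ tv) _.
  have hpow : (y + v * e2 - f (x + v * e1)) `^ (alpha - 1) <=
      rho `^ (alpha - 1) * v `^ (alpha - 1).
    rewrite -powRM ?(ltW rho0) ?(ltW v0)// -(opprB 1 alpha) !powRN.
    rewrite lef_pV2 ?posrE ?powR_gt0 ?mulr_gt0//.
    apply: ge0_ler_powR; rewrite ?nnegrE ?(ltW tv)//.
      by rewrite subr_ge0 ltW.
      by rewrite mulr_ge0 ?ltW.
    by apply: hv; rewrite v0.
  apply: (@le_trans _ _ ((`|c1| + `|c2|) * (2 * rho) *
      (grad_const * (rho `^ (alpha - 1) * v `^ (alpha - 1))))).
    apply: ler_pM.
    - by apply: mulr_ge0; exact: addr_ge0.
    - by apply: mulr_ge0; [exact: grad_const_ge0|exact: powR_ge0].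
    - by rewrite ler_wpM2l// addr_ge0.
    - by rewrite ler_wpM2l// grad_const_ge0.
  rewrite -(mulr_powRB1 (ltW rho0) alpha0).
  by rewrite le_eqVlt; apply/orP; left; apply/eqP; ring.
Qed.

(** Two vertical moves of length [(L + 2) * h] and one move across at scale [h]. *)
Definition holder_const c1 c2 : R :=
  seg_const c1 c2 * (2 * (L + 2) `^ alpha + 1).

Lemma pot_vertical c1 c2 x y (rho : R) : 0 < rho -> 0 < y - f x ->
  `|pot c1 c2 x (y + rho) - pot c1 c2 x y| <= seg_const c1 c2 * rho `^ alpha.
Proof.
move=> rho0 t0.
have := @pot_segment c1 c2 x y 0 rho rho rho0; rewrite addr0; apply => //.
- by rewrite normr0 add0r gtr0_norm//; lra.
- by rewrite addrAC addr_gt0.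
- by move=> v v01; rewrite mulr0 addr0; lra.
Qed.

Lemma pot_holder c1 c2 x y x' y' (h : R) : 0 < h ->
  0 < y - f x -> 0 < y' - f x' -> `|x - x'| <= h -> `|y - y'| <= h ->
  `|pot c1 c2 x y - pot c1 c2 x' y'| <= holder_const c1 c2 * h `^ alpha.
Proof.
move=> h0 t0 t0' xh yh.
have L2 : 0 < L + 2 by rewrite ltr_wpDl.
(* Going across costs at most [L * h] of height through the graph and [h] through the ordinate;
   starting [(L + 2) * h] higher leaves at least [h]. *)
pose rho := (L + 2) * h.
have rho0 : 0 < rho by rewrite mulr_gt0.
have up := pot_vertical c1 c2 x y rho rho0 t0.
have up' := pot_vertical c1 c2 x' y' rho rho0 t0'.
have across : `|pot c1 c2 x' (y' + rho) - pot c1 c2 x (y + rho)| <=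
    seg_const c1 c2 * h `^ alpha.
  have := @pot_segment c1 c2 x (y + rho) (x' - x) (y' - y) h h0.
  have -> : x + (x' - x) = x' by ring.
  have -> : y + rho + (y' - y) = y' + rho by ring.
  apply.
  - by rewrite (distrC x') (distrC y') mulr_natl mulr2n lerD.
  - by rewrite addrAC addr_gt0.
  - by rewrite addrAC addr_gt0.
  - move=> v /andP[v0 v1].
    have hf := lipschitz_f (x + v * (x' - x)) x.
    have : `|x + v * (x' - x) - x| <= h.
      rewrite addrAC subrr add0r normrM gtr0_norm// distrC.
      by rewrite (le_trans _ xh)// ler_piMl// ltW.
    move=> /(ler_wpM2l L0)/(le_trans hf)/(le_trans (ler_norm _)) hf'.
    have : - h <= v * (y' - y).
      rewrite lerNl (le_trans (ler_norm _))// normrN normrM gtr0_norm// distrC.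
      by rewrite (le_trans _ yh)// ler_piMl// ltW.
    have : h * v <= h by rewrite ler_piMr// ltW.
    by rewrite /rho; nra.
have -> : pot c1 c2 x y - pot c1 c2 x' y' =
    - (pot c1 c2 x (y + rho) - pot c1 c2 x y)
    - (pot c1 c2 x' (y' + rho) - pot c1 c2 x (y + rho))
    + (pot c1 c2 x' (y' + rho) - pot c1 c2 x' y') by ring.
rewrite (le_trans (ler_normD _ _))//.
rewrite (le_trans (lerD (ler_normB _ _) up'))//.
rewrite normrN (le_trans (lerD (lerD up across) (lexx _)))//.
rewrite /holder_const /rho powRM ?(ltW L2) ?(ltW h0)//.
by rewrite le_eqVlt; apply/orP; left; apply/eqP; ring.
Qed.

Lemma holder_const_ge0 c1 c2 : 0 <= holder_const c1 c2.
Proof.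
by rewrite mulr_ge0 ?seg_const_ge0// addr_ge0// mulr_ge0// powR_ge0.
Qed.

Lemma pot_bounded c1 c2 x y : 0 < y - f x ->
  `|pot c1 c2 x y| <= far_const c1 c2 + seg_const c1 c2.
Proof.
move=> t0; have up := pot_vertical c1 c2 x y 1 ltr01 t0.
rewrite powR1 mulr1 in up.
have -> : pot c1 c2 x y = pot c1 c2 x (y + 1) - (pot c1 c2 x (y + 1) - pot c1 c2 x y).
  by ring.
rewrite (le_trans (ler_normB _ _))// lerD//.
by apply: norm_pot_far_le; rewrite addrAC lerDr ltW.
Qed.

Lemma BUC_pot (c c1 c2 : R) :
  BUC (@dist2 R) alpha (Omega_plus f) (fun z => c * pot c1 c2 z.1 z.2).
Proof.
have d_le (z z' : R * R) : `|z.1 - z'.1| <= dist2 z z' /\ `|z.2 - z'.2| <= dist2 z z'.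
  rewrite /dist2 -!sqrtr_sqr; split; apply: ler_wsqrtr.
    by rewrite lerDl sqr_ge0.
  by rewrite lerDr sqr_ge0.
have d_ge0 (z z' : R * R) : 0 <= dist2 z z' by rewrite sqrtr_ge0.
have d_gt0 (z z' : R * R) : z <> z' -> 0 < dist2 z z'.
  move=> zz'; rewrite lt_neqAle d_ge0 andbT eq_sym.
  apply: contra_notN zz' => /eqP d0; have [] := d_le z z'.
  rewrite d0 !normr_le0 !subr_eq0 => /eqP + /eqP.
  by case: z z' {d0} => [? ?] [? ?] /= -> ->.
apply: (@BUC_of_holder _ _ _ alpha (`|c| * holder_const c1 c2)
  (`|c| * (far_const c1 c2 + seg_const c1 c2))) => //.
- by rewrite mulr_ge0 ?holder_const_ge0.
- by move=> z zO; rewrite normrM ler_wpM2l//; exact: pot_bounded.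
- move=> z z' zO zO'; have [->|/d_gt0 d0] := pselect (z = z').
    rewrite subrr normr0; apply: mulr_ge0; last exact: powR_ge0.
    by apply: mulr_ge0 => //; exact: holder_const_ge0.
  rewrite -mulrBr normrM -mulrA ler_wpM2l//.
  by have [] := d_le z z'; exact: pot_holder.
Qed.

End velocity_estimates.

(** * Constants from the hypotheses, and reflection *)

Lemma BUC_dist1_bounds (R : realType) (alpha : R) (u : R -> R) :
  BUC (@dist1 R) alpha setT u ->
  (exists2 B, 0 <= B & forall x, `|u x| <= B) /\
  (exists2 H, 0 <= H & forall x y, `|u x - u y| <= H * `|x - y| `^ alpha).
Proof.
move=> [[B [_ uB]] _ uoo]; split.
  (* Boundedness says only that every number above [B] is a bound, hence the added 1. *)
  exists (Num.max 0 B + 1); first by rewrite addr_ge0// le_max lexx.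
  move=> x; apply: (uB (Num.max 0 B + 1)) => //.
  by rewrite ltr_pwDr// le_max lexx orbT.
have d0 (x y : R) : x <> y -> 0 < dist1 x y.
  by move=> /eqP xy; rewrite /dist1 normr_gt0 subr_eq0.
have [H H0 uH] := holder_seminorm_lty R R (@dist1 R) alpha setT u d0 uoo.
by exists H => // x y; exact: uH.
Qed.

(** The seminorm ranges over distinct points and [d] is an arbitrary function, so injectivity is
    asked for besides the preservation of [d]. *)
Lemma BUC_comp_isometry (R : realType) (T : Type) (d : T -> T -> R) (alpha : R)
    (Omega Omega' : set T) (i : T -> T) (u : T -> R) :
  (forall x, Omega' x -> Omega (i x)) -> (forall x y, d (i x) (i y) = d x y) ->
  injective i -> BUC d alpha Omega u -> BUC d alpha Omega' (u \o i).
Proof.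
move=> iO di inj_i [[B [Br uB]] uc uoo]; split.
- by exists B; split => // M BM x Ox; apply: uB => //; exact: iO.
- move=> e e0; have [del del0 h] := uc e e0; exists del => // x y Ox Oy dxy.
  by apply: h; rewrite ?di//; exact: iO.
- apply: le_lt_trans uoo; apply: ub_ereal_sup => _ [x [y [Ox Oy xy ->]]].
  apply: ereal_sup_ubound; exists (i x), (i y); split; [exact: iO|exact: iO| |].
    by move=> /inj_i.
  by rewrite /= di.
Qed.

Theorem theoremA3 (R : realType) (p alpha : R) (omega f : R -> R)
  (hp : 1 < p)
  (halpha0 : 0 < alpha) (halpha1 : alpha < 1)
  (homega : BUC (@dist1 R) alpha setT omega)
  (homegap : omega \in Lfun (@lebesgue_measure R) p%:E)
  (hf : forall x : R, derivable f x 1)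
  (hf' : BUC (@dist1 R) alpha setT (derive1 f)) :
  BUC_vec (@dist2 R) alpha (Omega_plus f) (velocity f omega) /\
  BUC_vec (@dist2 R) alpha (Omega_minus f) (velocity f omega).
Proof.
have [[W W0 wW] [Hw Hw0 wH]] := BUC_dist1_bounds _ _ _ homega.
have [[L L0 gL] [H H0 gH]] := BUC_dist1_bounds _ _ _ hf'.
have iw := Lfun_integrable (ltW hp) homegap.
have fE (x : R) : is_derive x 1 f (derive1 f x).
  by apply: DeriveDef => //; rewrite derive1E.
have nfE (x : R) : is_derive x 1 (fun s => - f s) (- derive1 f x).
  exact: is_deriveN (fE x).
have ngL x : `|- derive1 f x| <= L by rewrite normrN.
have ngH x y : `|- derive1 f x - - derive1 f y| <= H * `|x - y| `^ alpha.
  by rewrite -opprD normrN.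
(* Reflection in the horizontal axis takes the region below the graph of [f] to the region above the
   graph of [- f]. *)
have refl (u : R * R -> R) : BUC (@dist2 R) alpha (Omega_plus (fun s => - f s)) u ->
    BUC (@dist2 R) alpha (Omega_minus f) (fun z => u (z.1, - z.2)).
  apply: (BUC_comp_isometry _ _ _ _ _ _ (fun z : R * R => (z.1, - z.2))).
  - by move=> z; rewrite /Omega_minus /Omega_plus /= opprK opprB addrC.
  - by move=> z z'; rewrite /dist2 /= -opprD sqrrN.
  - by move=> [? ?] [? ?] [-> /oppr_inj ->].
have plus := BUC_pot p alpha L H W Hw f (derive1 f) omega hp halpha0 halpha1
  L0 H0 W0 Hw0 fE gL gH wW wH iw (2 * pi)^-1.
have minus c1 c2 := refl _ (BUC_pot p alpha L H W Hw (fun s => - f s)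
  (fun s => - derive1 f s) omega hp halpha0 halpha1
  L0 H0 W0 Hw0 nfE ngL ngH wW wH iw (2 * pi)^-1 c1 c2).
split; split.
- congr (BUC _ _ _ _): (plus 1 0); apply/funext => -[x y] /=.
  congr (_ * _); apply: eq_Rintegral => s _; congr (_ * _).
  by rewrite /ker mul0r sub0r mul1r opprB.
- congr (BUC _ _ _ _): (plus 0 1); apply/funext => -[x y] /=.
  congr (_ * _); apply: eq_Rintegral => s _; congr (_ * _).
  by rewrite /ker mul0r subr0 mul1r.
(* Reflection changes the sign of [y - f s]. The first kernel is odd in it, hence the coefficient
   [-1]; the second is even and keeps its sign. *)
- congr (BUC _ _ _ _): (minus (-1) 0); apply/funext => -[x y] /=.
  congr (_ * _); apply: eq_Rintegral => s _; congr (_ * _).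
  by rewrite /ker mul0r sub0r mulN1r -opprD sqrrN opprK opprB.
- congr (BUC _ _ _ _): (minus 0 1); apply/funext => -[x y] /=.
  congr (_ * _); apply: eq_Rintegral => s _; congr (_ * _).
  by rewrite /ker mul0r subr0 mul1r -opprD sqrrN.
Qed.
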